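(* Let $R$ be a commutative Noetherian ring and let $\mathcal{F}=\{I_i\}_{i\in\mathbb{N}}$ and $\mathcal{G}=\{J_i\}_{i\in\mathbb{N}}$ be filtrations of $R$. Then the direct sum filtration $\mathcal{F}\bigoplus\mathcal{G}=\{I_i\oplus J_i\}_{i\in\mathbb{N}}$ of the ring $R\oplus R$ is strongly persistent if and only if both $\mathcal{F}$ and $\mathcal{G}$ are strongly persistent.
   Context: $\mathbb{N}$ denotes the nonnegative integers. A filtration of a ring $R$ is a family of ideals $\{I_n\}_{n\in\mathbb{N}}$ of $R$ such that (i) $I_0=R$; (ii) $I_{n+1}\subseteq I_n$ for all $n\in\mathbb{N}$; (iii) $I_nI_m\subseteq I_{n+m}$ for all $n,m\in\mathbb{N}$. The ring $R\oplus R$ is the product ring with componentwise operations, and for ideals $I,J$ of $R$, $I\oplus J=\{(a,b): a\in I,\ b\in J\}$, an ideal of $R\oplus R$. The family $\{I_i\oplus J_i\}_{i\in\mathbb{N}}$ is a filtration of $R\oplus R$. For ideals $A,B$ of a ring $S$, $(A:B)=\{x\in S: xB\subseteq A\}$. A filtration $\{I_i\}_{i\in\mathbb{N}}$ is strongly persistent if $(I_{i+1}:I_1)=I_i$ for all $i\in\mathbb{N}$. *)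

(* Defs.v *)
From HB Require Import structures.
From mathcomp Require Import all_boot all_order all_algebra.
From mathcomp Require Import mathcomp_extra boolp classical_sets.

Set Implicit Arguments.
Unset Strict Implicit.
Unset Printing Implicit Defensive.

Import GRing.Theory.
Local Open Scope classical_set_scope.
Local Open Scope ring_scope.

(* Rings are [comPzRingType]s, so that the zero ring is allowed; ideals are
   [Prop]-valued sets and may be the whole ring, unlike the (proper, boolean)
   ideals of [ring_quotient]. *)

Definition is_ideal (R : comPzRingType) (I : set R) : Prop :=
  [/\ I 0,
      forall x y, I x -> I y -> I (x + y)
    & forall a x, I x -> I (a * x)].

Definition ideal_gen (R : comPzRingType) (X : set R) : set R :=
  \bigcap_(I in [set I | is_ideal I /\ X `<=` I]) I.

Definition noetherian (R : comPzRingType) : Prop :=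
  forall I : set R, is_ideal I -> exists s : seq R, I = ideal_gen [set` s].

Definition ideal_mul (R : comPzRingType) (I J : set R) : set R :=
  ideal_gen [set x * y | x in I & y in J].

Definition ideal_colon (R : comPzRingType) (A B : set R) : set R :=
  [set x | [set x * b | b in B] `<=` A].

Record filtration (R : comPzRingType) := Filtration {
  fil_ideal :> nat -> set R;
  fil_is_ideal : forall n, is_ideal (fil_ideal n);
  fil_zero : fil_ideal 0%N = setT;
  fil_decr : forall n, fil_ideal n.+1 `<=` fil_ideal n;
  fil_mul : forall n m,
    ideal_mul (fil_ideal n) (fil_ideal m) `<=` fil_ideal (n + m)%N }.

Definition strongly_persistent (R : comPzRingType) (F : filtration R) : Prop :=
  forall i : nat, ideal_colon (F i.+1) (F 1%N) = F i.

Section DirectSum.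
Variables (R : comPzRingType) (F G : filtration R).

Definition dirsum (i : nat) : set (R * R)%type := F i `*` G i.

Lemma dirsum_is_ideal n : is_ideal (dirsum n).
Proof.
have [F0 FD FM] := fil_is_ideal F n; have [G0 GD GM] := fil_is_ideal G n.
split; first by split.
- by move=> x y [Fx Gx] [Fy Gy]; split; [apply: FD | apply: GD].
- by move=> a x [Fx Gx]; split; [apply: FM | apply: GM].
Qed.

Lemma dirsum_zero : dirsum 0 = setT.
Proof. by rewrite /dirsum !fil_zero setXTT. Qed.

Lemma dirsum_decr n : dirsum n.+1 `<=` dirsum n.
Proof. by move=> x [Fx Gx]; split; apply: fil_decr. Qed.

Lemma dirsum_mul n m : ideal_mul (dirsum n) (dirsum m) `<=` dirsum (n + m).
Proof.
move=> z; apply; split; first exact: dirsum_is_ideal.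
move=> _ [x [Fx Gx] [y [Fy Gy] <-]].
by split; apply: fil_mul => I [_]; apply; [exists x.1 => //; exists y.1
                                          | exists x.2 => //; exists y.2].
Qed.

Definition dirsum_filtration : filtration (R * R)%type :=
  Filtration dirsum_is_ideal dirsum_zero dirsum_decr dirsum_mul.

End DirectSum.

(* Main.v *)
(* Colon ideals of R (+) R are computed componentwise, and a product of two
   sets determines each of its factors as soon as the factors contain 0. *)
Require Import Defs.
From mathcomp Require Import all_boot all_order all_algebra.
From mathcomp Require Import classical_sets.

Set Implicit Arguments.
Unset Strict Implicit.
Unset Printing Implicit Defensive.

Import GRing.Theory.
Local Open Scope classical_set_scope.
Local Open Scope ring_scope.

(** Ideals contain 0, so a colon of products splits into the product of the colons ([ideal_colonX]).
    Strong persistence of the direct sum at [i] is thus one equality between two products of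
    nonempty sets, which amounts to equality of the factors ([setX_inj]), i.e. strong persistence of
    [F] and [G] at [i]. *)

Lemma ideal_colonX (R S : comPzRingType) (A B : set R) (C D : set S) :
  B 0 -> D 0 ->
  ideal_colon (A `*` C) (B `*` D) = ideal_colon A B `*` ideal_colon C D.
Proof.
move=> B0 D0; apply/seteqP; split => [x colx|x [colx1 colx2]].
  split=> _ [b Bb <-].
    (* Padding [b] with 0 gives an element of the product that tests one coordinate alone; this is
       where [D 0] is used, and [B 0] symmetrically. *)
    by have [] : (A `*` C) (x * (b, 0)) by apply: colx; exists (b, 0).
  by have [] : (A `*` C) (x * (0, b)) by apply: colx; exists (0, b).
move=> _ [b [Bb Db] <-].
by split; [apply: colx1; exists b.1 | apply: colx2; exists b.2].
Qed.

(** The points [a] and [b], common to both sides, exclude empty factors: each factor is recovered as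
    a slice through one of them. *)
Lemma setX_inj (T U : Type) (A A' : set T) (B B' : set U) a b :
  A a -> A' a -> B b -> B' b -> A `*` B = A' `*` B' -> A = A' /\ B = B'.
Proof.
move=> Aa A'a Bb B'b /seteqP[sub sup]; split; apply/seteqP; split => x Px.
- by have [] := sub (x, b) (conj Px Bb).
- by have [] := sup (x, b) (conj Px B'b).
- by have [] := sub (a, x) (conj Aa Px).
- by have [] := sup (a, x) (conj A'a Px).
Qed.

Lemma fil_ideal0 (R : comPzRingType) (F : filtration R) n : F n 0.
Proof. by have [] := fil_is_ideal F n. Qed.

Lemma ideal_colon0 (R : comPzRingType) (A B : set R) :
  A 0 -> ideal_colon A B 0.
Proof. by move=> A0 _ [b _ <-]; rewrite mul0r. Qed.

Theorem proposition4p5 (R : comPzRingType) (hR : noetherian R)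
    (F G : filtration R) :
  strongly_persistent (dirsum_filtration F G) <->
  strongly_persistent F /\ strongly_persistent G.
Proof.
have colonE i : ideal_colon (dirsum_filtration F G i.+1)
    (dirsum_filtration F G 1%N) =
    ideal_colon (F i.+1) (F 1%N) `*` ideal_colon (G i.+1) (G 1%N).
  by apply: ideal_colonX; apply: fil_ideal0.
split=> [spFG|[spF spG] i]; last by rewrite colonE spF spG.
have spE i : ideal_colon (F i.+1) (F 1%N) = F i /\
             ideal_colon (G i.+1) (G 1%N) = G i.
  have F0 := fil_ideal0 F; have G0 := fil_ideal0 G.
  (* The common point is 0, which lies in every ideal and every colon involved. *)
  apply: (setX_inj (ideal_colon0 (F0 _)) (F0 i) (ideal_colon0 (G0 _)) (G0 i)).
  by rewrite -colonE; exact: spFG.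
by split=> i; have [] := spE i.
Qed.
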